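(* Suppose that the DC/AC converter with AC circuit $$C\,\dot v_{\alpha\beta}=-i_{load}+i_{\alpha\beta},\qquad L\,\dot i_{\alpha\beta}=-R\,i_{\alpha\beta}+v_x-v_{\alpha\beta}$$ is interfaced with a constant load $i_{load}=G_{load}v_{\alpha\beta}$, where $$G_{load}=\begin{bmatrix}g&-b\\ b&g\end{bmatrix},\qquad g>0,\quad b\in\mathbb R,\quad b\neq-C\omega_s.$$ Then at steady state all AC signals synchronize at the same frequency $\omega_s$: writing $$v_{\alpha\beta}=\hat v\begin{bmatrix}-\sin\theta\\ \cos\theta\end{bmatrix},\quad i_{\alpha\beta}=\hat v_\ell\begin{bmatrix}-\sin\theta_\ell\\ \cos\theta_\ell\end{bmatrix},\quad v_x=\hat v_x\begin{bmatrix}-\sin\theta_x\\ \cos\theta_x\end{bmatrix},$$ with constant amplitudes $\hat v,\hat v_\ell,\hat v_x>0$ and $\dot\theta=\omega_s$, one has $$\dot\theta=\dot\theta_x=\dot\theta_\ell=\omega_s .$$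
   Context: $v_{\alpha\beta}(t)\in\mathbb R^2$ is the capacitor voltage, $i_{\alpha\beta}(t)\in\mathbb R^2$ the inductor current, $v_x(t)\in\mathbb R^2$ the voltage at the output of the modulation (switching) block; $C,L,R>0$ are constants and $\omega_s\in\mathbb R\setminus\{0\}$ is a constant frequency. The angles $\theta,\theta_\ell,\theta_x$ are differentiable functions of time. Steady state means that the AC amplitudes are constant and the capacitor voltage is harmonic with frequency $\omega_s$. *)

(* Defs.v *)
From mathcomp Require Import all_boot all_order all_algebra.
From mathcomp Require Import all_classical all_reals all_analysis.
Set Implicit Arguments.
Unset Strict Implicit.
Unset Printing Implicit Defensive.
Import Order.TTheory GRing.Theory Num.Theory.
Import numFieldNormedType.Exports.
Local Open Scope classical_set_scope.
Local Open Scope ring_scope.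

Definition ac_signal (R : realType) (amp : R) (angle : R -> R) (t : R) :
    'cV[R]_2 :=
  amp *: \col_(k < 2) [:: - sin (angle t); cos (angle t)]`_k.

Definition Gload (R : realType) (g b : R) : 'M[R]_2 :=
  \matrix_(j < 2, k < 2) (nth [::] [:: [:: g; - b]; [:: b; g]] j)`_k.

(* [C], [L], [r] are the capacitance, inductance and resistance. Differentiability
   is required explicitly because [derive1 f t] is total: without it the two
   equations would only constrain a default value. *)
Definition ac_circuit (R : realType) (C L r : R)
    (v i vx iload : R -> 'cV[R]_2) (t : R) : Prop :=
  [/\ derivable v t 1, derivable i t 1,
      C *: derive1 v t = - iload t + i t &
      L *: derive1 i t = - (r *: i t) + vx t - v t].

(* Main.v *)
Require Import Defs.
From mathcomp Require Import all_boot all_order all_algebra.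
From mathcomp Require Import all_classical all_reals all_analysis.
From mathcomp Require Import ring.
Set Implicit Arguments.
Unset Strict Implicit.
Unset Printing Implicit Defensive.
Import Order.TTheory GRing.Theory Num.Theory.
Import numFieldNormedType.Exports.
Local Open Scope classical_set_scope.
Local Open Scope ring_scope.

(** Identify the plane with the complex numbers, so that the quarter turn [J] is
    multiplication by the imaginary unit. A signal of constant amplitude and
    angle [psi] satisfies [f' = psi' J f] ([rotates_ac_signal]); conversely a
    nonzero amplitude lets one read [psi'] off this equation
    ([rotates_ac_signal_freq]). Hence it suffices to show that the current and
    the modulated voltage satisfy [f' = omega_s J f], as the capacitor voltage
    does.

    This property is inherited by [M f] for every constant matrix [M] commuting
    with [J] ([rotates_mulmx]), in particular for every matrix of the form
    [Gload g b], which is multiplication by [g + b 'i]. Now [v' = omega_s J v]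
    turns the capacitor equation into an algebraic identity [i = A v], with
    [A = G_load + C omega_s J]. So [i] rotates at [omega_s] too, and the inductor
    equation in turn becomes [vx = B i + v = (B A + 1) v], with
    [B = r + L omega_s J]. Both matrices commute with [J]. *)


(** Multiplication by the imaginary unit, when the plane is identified with the
    complex numbers. *)
Definition quarter_turn (R : realType) : 'M[R]_2 := Gload 0 1.

(** This includes the differentiability of [f] at [t], so that it determines the
    derivative and not just a default value. *)
Definition rotates (R : realType) (omega : R) (f : R -> 'cV[R]_2) (t : R) :=
  is_derive t 1 f (omega *: (quarter_turn R *m f t)).

(** These matrices represent complex numbers, whose product is commutative. *)
Lemma comm_Gload (R : realType) (a b c d : R) :
  comm_mx (Gload a b) (Gload c d).
Proof.
apply/matrixP => j k; rewrite !mxE !big_ord_recr !big_ord0 /= !mxE /=.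
by move: j k => [[|[|//]] ?] [[|[|//]] ?] /=; ring.
Qed.

(** Each entry of [M *m f s] is a fixed linear combination of entries of [f s],
    and matrix functions are differentiated entrywise. *)
Lemma is_derive_mulmx (R : realType) (m n p : nat) (M : 'M[R]_(m, n))
    (f : R -> 'M[R]_(n, p)) (t : R) (df : 'M[R]_(n, p)) :
  is_derive t 1 f df -> is_derive t 1 (fun s => M *m f s) (M *m df).
Proof.
move=> [f_drv <-].
have entry j k :
    is_derive t 1 (fun s => (M *m f s) j k) ((M *m 'D_1 f t) j k).
  have -> : (fun s => (M *m f s) j k) = \sum_l (M j l \*: (fun s => f s l k)).
    by apply/funext => s; rewrite mxE fct_sumE.
  rewrite mxE; apply: is_derive_sum => l.
  apply: is_deriveZ; rewrite derive_mx // mxE.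
  by apply/derivableP; move/derivable_mxP: f_drv; exact.
have Mf_drv : derivable (fun s => M *m f s) t 1.
  by apply/derivable_mxP => j k; case: (entry j k).
apply: DeriveDef => //; rewrite derive_mx //.
by apply/matrixP => j k; rewrite mxE; case: (entry j k).
Qed.

(** Derivatives are local, so rotation passes between signals that agree on an
    open set; this is how the circuit identities, valid on [T] only, are used
    under the derivative. *)
Lemma rotates_near (R : realType) (omega : R) (f g : R -> 'cV[R]_2) (T : set R)
    (t : R) :
  open T -> T t -> (forall s, T s -> g s = f s) ->
  rotates omega f t -> rotates omega g t.
Proof.
move=> openT Tt gf; rewrite /rotates gf //; apply: near_eq_is_derive.
by near=> s; rewrite gf //; near: s; exact: open_nbhs_nbhs.
Unshelve. all: by end_near. Qed.

(** [(M f)' = M (omega J f) = omega J (M f)]. *)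
Lemma rotates_mulmx (R : realType) (omega : R) (M : 'M[R]_2)
    (f : R -> 'cV[R]_2) (t : R) :
  comm_mx M (quarter_turn R) -> rotates omega f t ->
  rotates omega (fun s => M *m f s) t.
Proof.
move=> MJ /(is_derive_mulmx M).
by rewrite /rotates -scalemxAr !mulmxA MJ.
Qed.

(** The derivative of [(- sin, cos)] is [(- cos, - sin)], its image by the
    quarter turn. *)
Lemma rotates_ac_signal (R : realType) (amp : R) (angle : R -> R) (t : R) :
  derivable angle t 1 ->
  rotates (derive1 angle t) (ac_signal amp angle) t.
Proof.
move=> angle_drv.
have dangle : is_derive t 1 angle (derive1 angle t).
  by rewrite derive1E; exact/derivableP.
have entry j k : is_derive t 1 (fun s => ac_signal amp angle s j k)
    ((derive1 angle t *: (quarter_turn R *m ac_signal amp angle t)) j k).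
  rewrite !mxE !big_ord_recr big_ord0 /= !mxE /=.
  case: j => [[|[|//]] lt_j] /=.
  - have -> : (fun s => ac_signal amp angle s (Ordinal lt_j) k) =
              - amp \*: (sin \o angle).
      by apply/funext => s; rewrite !mxE /= mulrN -mulNr.
    apply: is_derive_eq; rewrite /GRing.scale /=; ring.
  - have -> : (fun s => ac_signal amp angle s (Ordinal lt_j) k) =
              amp \*: (cos \o angle).
      by apply/funext => s; rewrite !mxE.
    apply: is_derive_eq; rewrite /GRing.scale /=; ring.
have drv : derivable (ac_signal amp angle) t 1.
  by apply/derivable_mxP => j k; case: (entry j k).
apply: DeriveDef => //; rewrite derive_mx //.
by apply/matrixP => j k; rewrite mxE; case: (entry j k).
Qed.

(** The signal never vanishes, since its squared norm is [amp ^+ 2]; so neither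
    does its quarter turn, and the scalar in front of it is unique. *)
Lemma rotates_ac_signal_freq (R : realType) (amp omega : R) (angle : R -> R)
    (t : R) :
  amp != 0 -> derivable angle t 1 ->
  rotates omega (ac_signal amp angle) t -> derive1 angle t = omega.
Proof.
move=> amp0 /(rotates_ac_signal amp) [_ d1] [_ d2].
apply/eqP; rewrite -subr_eq0; apply/eqP.
set e := _ - _.
have /matrixP e0 : e *: (quarter_turn R *m ac_signal amp angle t) = 0.
  by rewrite scalerBl -d1 -d2 subrr.
move: (e0 ord0 ord0) (e0 ord_max ord0).
rewrite !mxE !big_ord_recr !big_ord0 /= !mxE /= => ec es.
(* Project onto the unit vector (- cos, - sin) to isolate [e * amp]. *)
have : e * amp * (cos (angle t) ^+ 2 + sin (angle t) ^+ 2) = 0.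
  rewrite -[RHS](mulr0 (- cos (angle t))) -[in RHS]ec.
  rewrite -[LHS]addr0 -[in LHS](mulr0 (sin (angle t))) -[in LHS]es; ring.
by rewrite cos2Dsin2 mulr1 => /eqP; rewrite mulf_eq0 (negPf amp0) orbF => /eqP.
Qed.

Theorem theorem5p3p2 (R : realType) (C L r omega_s : R)
    (hC : 0 < C) (hL : 0 < L) (hr : 0 < r) (homega : omega_s != 0)
    (g b : R) (hg : 0 < g) (hb : b != - (C * omega_s))
    (T : set R) (hT : open T)
    (v i vx iload : R -> 'cV[R]_2)
    (hcircuit : forall t, T t -> ac_circuit C L r v i vx iload t)
    (hload : forall t, T t -> iload t = Gload g b *m v t)
    (vhat vhat_l vhat_x : R)
    (hvhat : 0 < vhat) (hvhat_l : 0 < vhat_l) (hvhat_x : 0 < vhat_x)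
    (theta theta_l theta_x : R -> R)
    (hdtheta : forall t, T t -> derivable theta t 1)
    (hdtheta_l : forall t, T t -> derivable theta_l t 1)
    (hdtheta_x : forall t, T t -> derivable theta_x t 1)
    (hv : forall t, T t -> v t = ac_signal vhat theta t)
    (hi : forall t, T t -> i t = ac_signal vhat_l theta_l t)
    (hvx : forall t, T t -> vx t = ac_signal vhat_x theta_x t)
    (hfreq : forall t, T t -> derive1 theta t = omega_s) :
  forall t, T t ->
    [/\ derive1 theta t = derive1 theta_x t,
        derive1 theta_x t = derive1 theta_l t &
        derive1 theta_l t = omega_s].
Proof.
pose J := quarter_turn R.
pose A := Gload g b + (C * omega_s) *: J.
pose B := (L * omega_s) *: J + r%:M.
have v_rot t : T t -> rotates omega_s v t.
  move=> Tt; apply: (rotates_near hT Tt hv).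
  by rewrite -(hfreq t Tt); apply: rotates_ac_signal; exact: hdtheta.
have comm_polyJ a D : comm_mx D J -> comm_mx (a *: J + D) J.
  move=> DJ; by rewrite /comm_mx mulmxDl mulmxDr DJ -scalemxAl scalemxAr.
have AJ : comm_mx A J.
  by rewrite /A addrC; apply: comm_polyJ; exact: comm_Gload.
have BJ : comm_mx B J.
  by apply: comm_polyJ; apply/comm_mx_sym/comm_mx_scalar.
(* Capacitor equation: C v' = - G_load v + i, where v' = omega_s J v. *)
have iE t : T t -> i t = A *m v t.
  move=> Tt; have [_ _ + _] := hcircuit t Tt.
  have [_ dv] := v_rot t Tt; rewrite derive1E dv hload // => E.
  by rewrite mulmxDl -scalemxAl -scalerA E addrA subrr add0r.
have i_rot t : T t -> rotates omega_s i t.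
  by move=> Tt; apply: (rotates_near hT Tt iE); apply: rotates_mulmx (v_rot t Tt).
(* Inductor equation: L i' = - r i + vx - v, where i' = omega_s J i. *)
have vxE t : T t -> vx t = (B *m A + 1%:M) *m v t.
  move=> Tt; have [_ _ _] := hcircuit t Tt.
  have [_ di] := i_rot t Tt; rewrite derive1E di => E.
  rewrite mulmxDl -mulmxA -iE // mul1mx mulmxDl mul_scalar_mx -scalemxAl.
  by rewrite -scalerA E addrAC subrK addrAC addNr add0r.
have vx_rot t : T t -> rotates omega_s vx t.
  move=> Tt; apply: (rotates_near hT Tt vxE); apply: rotates_mulmx (v_rot t Tt).
  by rewrite /comm_mx mulmxDl mulmxDr mul1mx mulmx1 -mulmxA AJ mulmxA BJ mulmxA.
move=> t Tt.
have rot_signal amp psi w : 0 < amp -> derivable psi t 1 ->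
    (forall s, T s -> w s = ac_signal amp psi s) -> rotates omega_s w t ->
    derive1 psi t = omega_s.
  move=> amp0 dpsi wE w_rot; apply: (@rotates_ac_signal_freq _ amp) => //.
    exact: lt0r_neq0.
  by apply: (rotates_near hT Tt _ w_rot) => s /wE.
rewrite hfreq // (rot_signal _ _ _ hvhat_x (hdtheta_x t Tt) hvx (vx_rot t Tt)).
by rewrite (rot_signal _ _ _ hvhat_l (hdtheta_l t Tt) hi (i_rot t Tt)).
Qed.
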